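(* For a sofic shift $X$, the generalised left Fischer cover of $X$ is a foundation of the left Krieger cover of $X$, and no smaller (i.e. proper) subgraph of the generalised left Fischer cover is a foundation of the left Krieger cover.
   Context: A shift space over a finite alphabet $\mathcal{A}$ is a closed shift-invariant subset $X\subseteq\mathcal{A}^{\mathbb{Z}}$; $X^-$ and $X^+$ are the sets of left-rays $\cdots x_{-2}x_{-1}$ and right-rays $x_0x_1\cdots$ of its elements, and $P_\infty(x^+)=\{y^-\in X^-\mid y^-x^+\in X\}$. A labelled graph is a directed graph with a labelling of its edges; it presents the shift of label sequences of biinfinite paths, and a shift space is sofic if presented by a finite labelled graph. A labelled graph is left-resolving if no vertex receives two edges with the same label, and predecessor-separated if distinct vertices have distinct sets of labels of left-infinite paths terminating at them. Left Krieger cover of a sofic shift $X$: the labelled graph $(K,\mathcal{L}_K)$ with $K^0=\{P_\infty(x^+)\mid x^+\in X^+\}$ and an edge labelled $a$ from $P$ to $P'$ iff there is $x^+\in X^+$ with $P=P_\infty(ax^+)$, $P'=P_\infty(x^+)$. $P\in K^0$ is indecomposable if $V\subseteq K^0$, $P=\bigcup_{Q\in V}Q$ imply $P\in V$. Write $P\ge P'$ if there is a (possibly trivial) path in $K$ from $P$ to $P'$. The generalised left Fischer cover of $X$ is the labelled subgraph of $(K,\mathcal{L}_K)$ induced by $\{P\in K^0\mid P\ge P'\text{ for some indecomposable }P'\in K^0\}$. Foundations: let $\mathcal{E}=(E,\mathcal{L})$ be a finite left-resolving and predecessor-separated labelled graph over $\mathcal{A}$. For $V\subseteq E^0$ and a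 word $w$, let $wV$ be the set of vertices that are sources of paths labelled $w$ terminating in $V$. Let $S$ be a subset of the power set of $E^0$ and $\sim$ an equivalence relation on $S$. The pair $(S,\sim)$ is past closed if for all $u,v\in E^0$, $U,V\in S$, $a\in\mathcal{A}$: $\{v\}\in S$; $\{u\}\sim\{v\}$ implies $u=v$; $aV\neq\emptyset$ implies $aV\in S$; $U\sim V$ and $aU\neq\emptyset$ imply $aV\ne\emptyset$ and $aU\sim aV$. For $(S,\sim)$ past closed, $\mathcal{G}(\mathcal{E},S,\sim)$ is the labelled graph with vertex set $S/{\sim}$ and an edge labelled $a$ from $[aV]$ to $[V]$ whenever $aV\neq\emptyset$. $\mathcal{E}$ is a foundation of a labelled graph $\mathcal{H}$ if $\mathcal{H}$ is isomorphic, as a labelled graph, to $\mathcal{G}(\mathcal{E},S,\sim)$ for some past closed pair $(S,\sim)$. *)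

(* Defs.v *)
From HB Require Import structures.
From mathcomp Require Import all_boot all_order all_algebra.
From mathcomp Require Import mathcomp_extra boolp classical_sets functions.
From mathcomp Require Import cardinality topology.

Set Implicit Arguments.
Unset Strict Implicit.
Unset Printing Implicit Defensive.

Import GRing.Theory.
Local Open Scope classical_set_scope.

(* Parallel edges are allowed, even with equal labels. *)
Record lgraph (A : Type) := LGraph {
  vert : Type;
  edge : Type;
  src : edge -> vert;
  rng : edge -> vert;
  lab : edge -> A }.

(* The labelled graph with exactly one edge labelled a from u to v whenever
   R u a v holds. *)
Definition rel_graph (A V : Type) (R : V -> A -> V -> Prop) : lgraph A :=
  @LGraph A V [set t : V * A * V | R t.1.1 t.1.2 t.2]
    (fun e => (val e).1.1) (fun e => (val e).2) (fun e => (val e).1.2).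

Definition lgraph_iso (A : Type) (G H : lgraph A) : Prop :=
  exists (f : vert G -> vert H) (g : edge G -> edge H),
    [/\ bijective f, bijective g
      & forall e, [/\ src (g e) = f (src e), rng (g e) = f (rng e)
                    & lab (g e) = lab e]].

Record subgraph (A : Type) (G : lgraph A) := Subgraph {
  sub_vert : set (vert G);
  sub_edge : set (edge G);
  sub_src : forall e, sub_edge e -> sub_vert (src e);
  sub_rng : forall e, sub_edge e -> sub_vert (rng e) }.

Definition subgraph_lgraph (A : Type) (G : lgraph A) (F : subgraph G) :
    lgraph A :=
  @LGraph A (sub_vert F) (sub_edge F)
    (fun e => SigSub (mem_set (sub_src (set_valP e))))
    (fun e => SigSub (mem_set (sub_rng (set_valP e))))
    (fun e => lab (val e)).
Coercion subgraph_lgraph : subgraph >-> lgraph.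

Definition proper_subgraph (A : Type) (G : lgraph A) (F : subgraph G) : Prop :=
  ~ (sub_vert F = setT /\ sub_edge F = setT).

Definition induced_subgraph (A : Type) (G : lgraph A) (W : set (vert G)) :
    subgraph G :=
  @Subgraph A G W [set e | W (src e) /\ W (rng e)]
    (fun _ h => proj1 h) (fun _ h => proj2 h).

Fixpoint is_path (A : Type) (G : lgraph A) (u : vert G) (p : seq (edge G))
    (v : vert G) : Prop :=
  if p is e :: q then src e = u /\ is_path (rng e) q v else u = v.

(* The set written wV. *)
Definition word_preim (A : Type) (G : lgraph A) (w : seq A)
    (V : set (vert G)) : set (vert G) :=
  [set u | exists p v, [/\ V v, is_path u p v & map (@lab A G) p = w]].

Definition biinf_path (A : Type) (G : lgraph A) (p : int -> edge G) : Prop :=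
  forall i : int, rng (p i) = src (p (i + 1)%R).

(* A left-infinite sequence ... y_{-2} y_{-1} is encoded as y : nat -> _, with
   y n the entry at position -(n + 1). *)
Definition left_path (A : Type) (G : lgraph A) (p : nat -> edge G)
    (v : vert G) : Prop :=
  rng (p 0%N) = v /\ forall n, rng (p n.+1) = src (p n).

Definition past (A : Type) (G : lgraph A) (v : vert G) : set (nat -> A) :=
  [set y | exists2 p : nat -> edge G, left_path p v &
                                      forall n, lab (p n) = y n].

Definition finite_lgraph (A : Type) (G : lgraph A) : Prop :=
  finite_set [set: vert G] /\ finite_set [set: edge G].

Definition left_resolving (A : Type) (G : lgraph A) : Prop :=
  forall e f : edge G, rng e = rng f -> lab e = lab f -> e = f.

Definition predecessor_separated (A : Type) (G : lgraph A) : Prop :=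
  forall u v : vert G, past u = past v -> u = v.

Definition presented_shift (A : Type) (G : lgraph A) : set (int -> A) :=
  [set x | exists2 p : int -> edge G, biinf_path p & forall i, lab (p i) = x i].

Definition shift_map (A : Type) (x : int -> A) : int -> A :=
  fun i => x (i + 1)%R.

Definition shift_space (A : finType) (X : set (int -> A)) : Prop :=
  closed (X : set {ptws int -> discrete_topology A}) /\
  @shift_map A @` X = X.

Definition sofic (A : finType) (X : set (int -> A)) : Prop :=
  shift_space X /\
  exists G : lgraph A, finite_lgraph G /\ X = presented_shift G.

Section KriegerCover.
Variable A : Type.
Implicit Type X : set (int -> A).

(* Negz n is the integer -(n + 1). *)
Definition left_rays X : set (nat -> A) :=
  [set (fun n => x (Negz n)) | x in X].

Definition right_rays X : set (nat -> A) :=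
  [set (fun n => x (Posz n)) | x in X].

Definition glue (y x : nat -> A) : int -> A :=
  fun i => match i with Posz n => x n | Negz n => y n end.

Definition cons_ray (a : A) (x : nat -> A) : nat -> A :=
  fun n => if n is m.+1 then x m else a.

Definition Pinf X (x : nat -> A) : set (nat -> A) :=
  [set y | left_rays X y /\ X (glue y x)].

Definition krieger_vert X : set (set (nat -> A)) :=
  [set Pinf X x | x in right_rays X].

Definition krieger X : lgraph A :=
  @rel_graph A (krieger_vert X) (fun P a P' =>
    exists x, [/\ right_rays X x, val P = Pinf X (cons_ray a x)
                & val P' = Pinf X x]).

Definition indecomposable X (P : vert (krieger X)) : Prop :=
  forall V : set (vert (krieger X)), val P = \bigcup_(Q in V) val Q -> V P.

Definition glfc X : subgraph (krieger X) :=
  induced_subgraph [set P : vert (krieger X) |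
    exists P', indecomposable P' /\ exists p, is_path P p P'].

End KriegerCover.

(* sim is only constrained on S; its values elsewhere are irrelevant. *)
Definition equivalence_on (T : Type) (S : set T) (sim : T -> T -> Prop) : Prop :=
  [/\ forall U, S U -> sim U U,
      forall U V, S U -> S V -> sim U V -> sim V U
    & forall U V W, S U -> S V -> S W -> sim U V -> sim V W -> sim U W].

Section Foundation.
Variables (A : Type) (E : lgraph A).
Implicit Types (S : set (set (vert E))).
Implicit Types (sim : set (vert E) -> set (vert E) -> Prop).

Definition past_closed S sim : Prop :=
  [/\ forall v, S [set v],
      forall u v, sim [set u] [set v] -> u = v,
      forall V a, S V -> word_preim [:: a] V !=set0 -> S (word_preim [:: a] V)
    & forall U V a, S U -> S V -> sim U V -> word_preim [:: a] U !=set0 ->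
        word_preim [:: a] V !=set0 /\
        sim (word_preim [:: a] U) (word_preim [:: a] V)].

Definition eq_class S sim (V : set (vert E)) : set (set (vert E)) :=
  [set U | S U /\ sim V U].

Definition quotient_by S sim : set (set (set (vert E))) :=
  [set eq_class S sim V | V in S].

Definition foundation_graph S sim : lgraph A :=
  @rel_graph A (quotient_by S sim) (fun C a D =>
    exists V, [/\ S V, word_preim [:: a] V !=set0,
                  val C = eq_class S sim (word_preim [:: a] V)
                & val D = eq_class S sim V]).

Definition foundation (H : lgraph A) : Prop :=
  [/\ finite_lgraph E, left_resolving E, predecessor_separated E
    & exists S sim, [/\ equivalence_on S sim, past_closed S sim
                      & lgraph_iso H (foundation_graph S sim)]].

End Foundation.

(* Main.v *)
(* In the Krieger cover K of a sofic shift the set of pasts of a vertex P is P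
   itself, and an edge labelled a runs from P to P' iff P = {y | ya in P'}.
   Each P is the union of the indecomposable vertices it contains, so the
   vertices of the generalised left Fischer cover have all vertices of K as
   unions: take S to be the sets of vertices whose union is a vertex of K, and
   identify sets with the same union.  Conversely, if F is a foundation of K,
   compactness shows that the past of a class [V] is the union of the pasts of
   the v in V.  Hence v |-> [{v}] embeds F into K with an image that contains
   the indecomposables and is closed under predecessors, so it contains the
   generalised left Fischer cover; by finiteness a subgraph F of the latter
   cannot be proper. *)
Require Import Defs.
From mathcomp Require Import all_boot all_algebra classical_sets.
From mathcomp Require Import boolp cardinality.

Set Implicit Arguments.
Unset Strict Implicit.
Unset Printing Implicit Defensive.

Local Open Scope classical_set_scope.

(** * Finite sets, pigeonhole arguments and compactness *)

Lemma inj_surj_bijective (T U : Type) (f : T -> U) :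
  injective f -> (forall u, exists t, f t = u) -> bijective f.
Proof.
move=> injf surjf; have [g fgK] := choice surjf.
by exists g => // t; apply: injf; rewrite fgK.
Qed.

Lemma finite_nat_not_inj (T : Type) (f : nat -> T) :
  finite_set [set: T] -> ~ injective f.
Proof.
move=> finT injf; apply: infinite_nat.
have -> : [set: nat] = f @^-1` setT by [].
by apply: finite_preimage => // m n _ _; apply: injf.
Qed.

(** The iterates of a point missed by [s] would be pairwise distinct. *)
Lemma finite_inj_surj (T : Type) (s : T -> T) :
  finite_set [set: T] -> injective s -> forall y, exists x, s x = y.
Proof.
move=> finT injs y; apply: contrapT => sNy.
apply: (finite_nat_not_inj (f := fun n => iter n s y) finT).
elim=> [|m IHm] [|n] //=.
- by move=> e; case: sNy; exists (iter n s y).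
- by move=> e; case: sNy; exists (iter m s y).
- by move=> /injs /IHm ->.
Qed.

(** Otherwise dependent choice yields an infinite strictly descending sequence, which never repeats
    a value. *)
Lemma finite_minimal (T : Type) (lt : T -> T -> Prop) (D : set T) :
  finite_set [set: T] -> (forall t, ~ lt t t) ->
  (forall t u v, lt t u -> lt u v -> lt t v) -> D !=set0 ->
  exists2 t, D t & forall u, D u -> ~ lt u t.
Proof.
move=> finT irr tr [t0 Dt0]; apply: contrapT => Nmin.
have next (t : {t | D t}) : {u : {t | D t} | lt (sval u) (sval t)}.
  apply: cid; apply: contrapT => Nu; apply: Nmin; exists (sval t).
    exact: (svalP t).
  by move=> u Du ltut; apply: Nu; exists (exist _ u Du).
have [f [_ fS]] := dependent_choice next (exist _ t0 Dt0).
have fD m n : lt (sval (f (m + n).+1)) (sval (f m)).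
  elim: n => [|n IHn]; first by rewrite addn0.
  by rewrite addnS; apply: tr (fS _) IHn.
have fN m n : m < n -> sval (f m) <> sval (f n).
  by move=> /subnKC <- e; have := fD m (n - m.+1); rewrite -addSn -e; apply: irr.
apply: (finite_nat_not_inj (f := fun n => sval (f n)) finT) => m n /= e.
by case: (ltngtP m n) => // /fN; rewrite e.
Qed.

(** If each [t] failed at some [N t], then by monotonicity all of them would fail at the maximum of
    these finitely many levels. *)
Lemma finite_forall_exists (T : Type) (P : T -> nat -> Prop) :
  finite_set [set: T] -> (forall t m n, m <= n -> P t n -> P t m) ->
  (forall n, exists t, P t n) -> exists t, forall n, P t n.
Proof.
move=> finT Pmono Pex; apply: contrapT => NP.
have /choice[N NN] t : exists n, ~ P t n.
  apply: contrapT => Nt; apply: NP; exists t => n.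
  by apply: contrapT => NPn; apply: Nt; exists n.
have /finite_seqP[s sE] := finite_image N finT.
have [t Pt] := Pex (\max_(i <- s) i).
apply: (NN t); apply: Pmono Pt; apply: (bigmaxn_sup_seq (N t)) => //.
have : (N @` setT) (N t) by exists t.
by rewrite sE.
Qed.

Lemma finite_powerset (T : Type) :
  finite_set [set: T] -> finite_set [set: set T].
Proof.
move=> /(@finite_seqP {classic T})[s sE].
pose F (m : (size s).-tuple bool) : set T := [set` mask m s].
apply: (@sub_finite_set _ _ (F @` setT)); last exact: finite_image.
move=> W _; exists (map_tuple (fun x => `[< W x >]) (in_tuple s)) => //.
apply/seteqP; split=> x; rewrite /F /= -filter_mask mem_filter.
  by case/andP=> /asboolP.
move=> Wx; rewrite asboolT //=.
by have : [set: {classic T}] x by []; rewrite sE.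
Qed.

Lemma finite_set_type (T : Type) (A : set T) :
  finite_set A -> finite_set [set: A].
Proof.
move=> finA; have -> : [set: A] = val @^-1` A.
  by apply/seteqP; split=> // x _; exact: set_valP.
by apply: finite_preimage => // x y _ _; exact: val_inj.
Qed.

(** König's lemma for runs read backwards in time. The relation depends on the position [i], so that
    it can record the [i]-th letter of a left-ray. *)
Lemma konig (T : Type) (R : nat -> T -> T -> Prop) (W : set T) :
  finite_set [set: T] ->
  (forall k, exists2 t : nat -> T, W (t 0) &
               forall i, i < k -> R i (t i.+1) (t i)) ->
  exists2 t : nat -> T, W (t 0) & forall i, R i (t i.+1) (t i).
Proof.
move=> finT Wk.
pose reach n k v := exists2 t : nat -> T, t 0 = v &
  forall i, i < k -> R (n + i) (t i.+1) (t i).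
have reach_mono n v j k : j <= k -> reach n k v -> reach n j v.
  by move=> jk [t t0 tR]; exists t => // i ij; apply: tR; apply: leq_trans jk.
have [v0 v0P] : exists v, forall k, W v /\ reach 0 k v.
  apply: finite_forall_exists => // [v j k jk [Wv /(reach_mono _ _ _ _ jk)]//|k].
  by have [t Wt tR] := Wk k; exists (t 0); split=> //; exists t.
(* A good state starts runs of every finite length. By pigeonhole one and the same predecessor
   serves all lengths, so a good state has a good successor. *)
pose good (s : nat * T) := forall k, reach s.1 k s.2.
have next (s : sig good) : {s' : sig good | (sval s').1 = (sval s).1.+1 /\
    R (sval s).1 (sval s').2 (sval s).2}.
  apply: cid; case: s => -[n v] /= vP.
  have [u uP] : exists u, forall k, R n u v /\ reach n.+1 k u.
    apply: finite_forall_exists => // [u j k jk [Ru /(reach_mono _ _ _ _ jk)]//|k].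
    have [t t0 tR] := vP k.+1; exists (t 1); split.
      by have := tR 0 isT; rewrite addn0 t0.
    exists (fun i => t i.+1) => // i ik.
    by rewrite addSnnS; apply: tR.
  by exists (exist good (n.+1, u) (fun k => (uP k).2)); split=> //; have [] := uP 0.
have [f [f0 fS]] :=
  dependent_choice next (exist good (0, v0) (fun k => (v0P k).2)).
have f1 n : (sval (f n)).1 = n.
  by elim: n => [|n IHn]; [rewrite f0 | rewrite (fS n).1 IHn].
exists (fun n => (sval (f n)).2); first by rewrite f0; have [] := v0P 0.
by move=> n; rewrite -{1}(f1 n); exact: (fS n).2.
Qed.

(** * Labelled graphs through their one-edge relation; pasts and isomorphisms *)

Section LabelledGraphs.
Variables (A : Type).
Implicit Types G H : lgraph A.

Definition step G (u : vert G) (a : A) (v : vert G) : Prop :=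
  exists e, [/\ src e = u, rng e = v & lab e = a].

Definition future G (v : vert G) : set (nat -> A) :=
  [set x | exists2 p : nat -> edge G,
     src (p 0) = v /\ (forall n, rng (p n) = src (p n.+1)) &
     forall n, lab (p n) = x n].

Lemma word_preim1 G a (V : set (vert G)) (u : vert G) :
  word_preim [:: a] V u <-> exists2 v, V v & step u a v.
Proof.
split=> [[[|e [|? ?]] [v [Vv]]] //= [eu ev] [ea]|[v Vv [e [eu ev ea]]]].
  by exists v => //; exists e.
by exists [:: e], v; rewrite /= ea; split.
Qed.

Lemma pastE G (v : vert G) y :
  past v y <-> exists2 t, t 0 = v & forall n, step (t n.+1) (y n) (t n).
Proof.
split=> [[p [p0 pS] py]|[t t0 /choice[p pP]]].
  exists (fun n => rng (p n)) => // n.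
  by exists (p n); split=> //; rewrite pS.
exists p => [|n]; last by have [] := pP n.
split=> [|n]; first by have [_ -> _] := pP 0.
by have [-> _ _] := pP n; have [_ -> _] := pP n.+1.
Qed.

Lemma past_konig G (W : set (vert G)) y :
  finite_set [set: vert G] ->
  (forall k, exists2 t : nat -> vert G, W (t 0) &
               forall i, i < k -> step (t i.+1) (y i) (t i)) ->
  exists2 v, W v & past v y.
Proof.
move=> finG Wk.
have [t Wt tS] := konig (R := fun i u v => step u (y i) v) finG Wk.
by exists (t 0) => //; apply/pastE; exists t.
Qed.

Lemma step_rel_graph (V : Type) (R : V -> A -> V -> Prop) u a v :
  @step (rel_graph R) u a v <-> R u a v.
Proof.
split=> [[e [<- <- <-]]|uv]; first exact: (set_valP e).
by exists (SigSub (mem_set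
  (uv : [set t : V * A * V | R t.1.1 t.1.2 t.2] (u, a, v)))).
Qed.

Lemma edge_rel_graph_inj (V : Type) (R : V -> A -> V -> Prop)
    (e f : edge (rel_graph R)) :
  src e = src f -> rng e = rng f -> lab e = lab f -> e = f.
Proof.
case: e f => [[[u a] v] ue] [[[u' a'] v'] ve] /= eu ev ea.
by apply: val_inj => /=; move: eu ev ea => /= -> -> ->.
Qed.

Lemma step_induced G (W : set (vert G)) (u v : vert (induced_subgraph W)) a :
  step u a v <-> step (val u) a (val v).
Proof.
split=> [[e [<- <- <-]]|[e [eu ev ea]]]; first by exists (val e).
have We : [set e | W (src e) /\ W (rng e)] e.
  by rewrite /= eu ev; split; exact: set_valP.
by exists (SigSub (mem_set We)); split=> //; apply: val_inj.
Qed.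

(** An edge of a [rel_graph] is determined by its ends and its label, so the vertex bijection forces
    the edge bijection. *)
Lemma rel_graph_iso (V V' : Type) (R : V -> A -> V -> Prop)
    (R' : V' -> A -> V' -> Prop) (f : V -> V') :
  bijective f ->
  (forall u a v,
    @step (rel_graph R) u a v <-> @step (rel_graph R') (f u) a (f v)) ->
  lgraph_iso (rel_graph R) (rel_graph R').
Proof.
move=> bijf RR'.
have /choice[g gP] (e : edge (rel_graph R)) : exists e' : edge (rel_graph R'),
    [/\ src e' = f (src e), rng e' = f (rng e) & lab e' = lab e].
  by apply/RR'; exists e.
exists f, g; split=> //; apply: inj_surj_bijective => [e1 e2 e12|e'].
  have [[s1 r1 l1] [s2 r2 l2]] := (gP e1, gP e2).
  apply: edge_rel_graph_inj.
  - by apply: (bij_inj bijf); rewrite -s1 -s2 e12.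
  - by apply: (bij_inj bijf); rewrite -r1 -r2 e12.
  - by rewrite -l1 -l2 e12.
have [f' fK f'K] := bijf.
have : @step (rel_graph R) (f' (src e')) (lab e') (f' (rng e')).
  by apply/RR'; rewrite !f'K; exists e'.
move=> [e [es er el]]; exists e; have [s r l] := gP e.
by apply: edge_rel_graph_inj; rewrite ?s ?r ?l ?es ?er ?el ?f'K.
Qed.

Lemma lgraph_iso_step G H : lgraph_iso G H ->
  exists2 f : vert G -> vert H, bijective f &
    forall u a v, step u a v <-> step (f u) a (f v).
Proof.
move=> [f [g [bijf [g' gK g'K] fg]]]; exists f => // u a v.
split=> [[e [<- <- <-]]|[e [eu ev <-]]].
  by exists (g e); have [] := fg e.
have [s r l] := fg (g' e); rewrite g'K in s r l.
by exists (g' e); split=> //; apply: (bij_inj bijf); congruence.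
Qed.

Lemma past_iso G H (f : vert G -> vert H) :
  bijective f -> (forall u a v, step u a v <-> step (f u) a (f v)) ->
  forall v, past (f v) = past v.
Proof.
move=> [f' fK f'K] fS v; apply/seteqP; split=> y /pastE[t t0 tS]; apply/pastE.
  exists (f' \o t) => [|n] /=; first by rewrite t0.
  by apply/fS; rewrite !f'K.
by exists (f \o t) => [|n] /=; [rewrite t0 | apply/fS].
Qed.

End LabelledGraphs.

Lemma finite_rel_graph (A : finType) (V : Type) (R : V -> A -> V -> Prop) :
  finite_set [set: V] -> finite_lgraph (rel_graph R).
Proof.
move=> finV; split=> //; apply: finite_set_type.
apply: (@sub_finite_set _ _ (([set: V] `*` [set: A]) `*` [set: V])).
  by [].
by apply: finite_setX => //; apply: finite_setX.
Qed.

(** * Edges and pasts in the graph of a past closed pair *)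

Section Quotient.
Variables (A : Type) (E : lgraph A) (S : set (set (vert E))).
Variable sim : set (vert E) -> set (vert E) -> Prop.
Hypothesis simP : equivalence_on S sim.
Hypothesis pcS : past_closed S sim.

Lemma eq_class_inj U V : S U -> S V ->
  eq_class S sim U = eq_class S sim V -> sim U V.
Proof.
move=> SU SV UV; have [rf _ _] := simP.
have : eq_class S sim V V by split=> //; exact: rf.
by rewrite -UV => -[].
Qed.

Lemma eq_class_sim U V : S U -> S V -> sim U V ->
  eq_class S sim U = eq_class S sim V.
Proof.
move=> SU SV UV; have [rf sy tr] := simP.
apply/seteqP; split=> W [SW sW]; split=> //.
  by apply: (tr _ U) => //; exact: sy.
exact: (tr _ V).
Qed.

Definition quot V (SV : S V) : vert (foundation_graph S sim) :=
  SigSub (mem_set (ex_intro2 _ _ V SV erefl : quotient_by S sim (eq_class S sim V))).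

Lemma quot_surj (C : vert (foundation_graph S sim)) :
  exists V (SV : S V), C = quot SV.
Proof.
by have [V SV CV] := set_valP C; exists V, SV; apply: val_inj; rewrite /= CV.
Qed.

(** The edge may be witnessed by another representative [U] of the class of [V]; past closedness
    transfers the witness to [V]. *)
Lemma step_quotP (C : vert (foundation_graph S sim)) a V (SV : S V) :
  step C a (quot SV) <->
  word_preim [:: a] V !=set0 /\ val C = eq_class S sim (word_preim [:: a] V).
Proof.
have [_ _ pS pE] := pcS; split=> [/step_rel_graph[U [SU aU -> /=]]|[aV CV]].
  move=> VU; have UV := eq_class_inj SU SV (esym VU).
  have [aV saUV] := pE _ _ a SU SV UV aU; split=> //.
  by apply: eq_class_sim => //; apply: pS.
by apply/step_rel_graph; exists V.
Qed.

Lemma past_quot V (SV : S V) :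
  finite_set [set: vert E] -> past (quot SV) = \bigcup_(v in V) past v.
Proof.
move=> finE; have [_ _ pS _] := pcS; apply/seteqP; split=> y.
  move=> /pastE[t t0 tS]; apply: past_konig => // k.
  (* Walking back along the classes, [W] is the preimage of [V] under the first [k] letters of [y].
     It is nonempty, so paths of every finite length end in [V], and compactness applies. *)
  suff : exists W (SW : S W), t k = quot SW /\ (forall w, W w ->
      exists2 s : nat -> vert E, V (s 0) &
        s k = w /\ forall i, i < k -> step (s i.+1) (y i) (s i)).
    move=> [W [SW [tW WP]]].
    have := tS k; rewrite tW => /step_quotP[[u /word_preim1[w Ww _]] _].
    by have [s Vs [_ sS]] := WP w Ww; exists s.
  elim: k => [|k [W [SW [tW WP]]]].
    by exists V, SV; split=> // v Vv; exists (fun=> v).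
  have := tS k; rewrite tW => /step_quotP[aW tkW].
  exists (word_preim [:: y k] W), (pS _ _ SW aW); split; first exact: val_inj.
  move=> u /word_preim1[w Ww uw].
  have [s Vs [sk sS]] := WP w Ww.
  (* Only the value [u] at [k.+1] matters; later values are a default. *)
  exists (fun i => if i <= k then s i else u); first by [].
  rewrite ltnn; split=> // i; rewrite ltnS => ik; rewrite ik.
  case: ltngtP ik => // [ik|->] _; first exact: sS.
  by rewrite sk.
move=> [v Vv /pastE[t t0 tS]]; apply/pastE.
(* Conversely, the iterated preimages of [V] contain the vertices of the given path, hence stay
   nonempty, and their classes form a path. *)
pose W n := iteri n (fun i U => word_preim [:: y i] U) V.
have Wt n : W n (t n).
  elim: n => [|n IHn]; first by rewrite t0.
  by apply/word_preim1; exists (t n).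
have SW n : S (W n).
  elim: n => [|n IHn]; first exact: SV.
  by apply: pS => //; exists (t n.+1); exact: (Wt n.+1).
exists (fun n => quot (SW n)) => [|n]; first exact: val_inj.
by apply/step_quotP; split=> //; exists (t n.+1); exact: (Wt n.+1).
Qed.

End Quotient.

(** * Left-rays and the Krieger cover of a sofic shift *)

Lemma Posz_add1 n : (Posz n + 1)%R = Posz n.+1.
Proof. by rewrite intS GRing.addrC. Qed.

Lemma Negz_add1 n : (Negz n.+1 + 1)%R = Negz n.
Proof.
by rewrite !NegzE [in LHS]intS GRing.opprD GRing.addrAC GRing.addNr GRing.add0r.
Qed.

Section Krieger.
Variables (A : finType) (X : set (int -> A)).
Hypothesis soficX : sofic X.

(** As rays to the left are indexed away from the origin, this is the left-ray ending in the last
    [n] letters of [y], preceded by [z]. *)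
Definition cat_ray (n : nat) (y z : nat -> A) : nat -> A :=
  fun i => if i < n then y i else z (i - n).

Lemma cat_ray0 y z : cat_ray 0 y z = z.
Proof. by apply/funext => i; rewrite /cat_ray subn0. Qed.

Lemma cat_rayS n y z : cat_ray n.+1 y z = cat_ray n y (cons_ray (y n) z).
Proof.
apply/funext => i; rewrite /cat_ray ltnS.
case: (ltngtP i n) => [//|ni|->]; last by rewrite subnn.
by rewrite -[i - n]prednK ?subn_gt0 // subnS.
Qed.

Lemma cat_ray_drop n y : cat_ray n y (fun i => y (n + i)) = y.
Proof.
by apply/funext => i; rewrite /cat_ray; case: ltnP => // /subnKC ->.
Qed.

Lemma PinfE x : Pinf X x = [set y | X (glue y x)].
Proof.
by apply/seteqP; split=> y => [[]|Xyx] //; split=> //; exists (glue y x).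
Qed.

Lemma Pinf_right_rays x : Pinf X x !=set0 -> right_rays X x.
Proof. by move=> [y [_ Xyx]]; exists (glue y x). Qed.

(** Moving [a] across the origin is a shift, and [X] is shift-invariant in both directions. *)
Lemma Pinf_cons a x : Pinf X (cons_ray a x) = [set y | Pinf X x (cons_ray a y)].
Proof.
have [[_ sX] _] := soficX.
have gS y : shift_map (glue y (cons_ray a x)) = glue (cons_ray a y) x.
  apply/funext => -[n|[|n]]; rewrite /shift_map.
  - by rewrite Posz_add1.
  - by [].
  - by rewrite Negz_add1.
rewrite !PinfE; apply/seteqP; split=> y /=; rewrite -gS.
  by move=> Xy; rewrite -sX; exists (glue y (cons_ray a x)).
rewrite -{1}sX => -[z Xz zE]; suff <- : z = glue y (cons_ray a x) by [].
apply/funext => i; have := congr1 (fun w => w (i - 1)%R) zE.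
by rewrite /shift_map GRing.subrK.
Qed.

(** A biinfinite path is cut at the source of its edge at position 0. *)
Lemma Pinf_presented (G : lgraph A) x : X = presented_shift G ->
  Pinf X x = \bigcup_(v in [set v : vert G | future v x]) past v.
Proof.
move=> XG; rewrite PinfE XG; apply/seteqP; split=> [y [p pb py]|y [v]].
  exists (src (p 0%R)).
    exists (fun n => p (Posz n)); last by move=> n; rewrite py.
    by split=> // n; rewrite pb Posz_add1.
  exists (fun n => p (Negz n)); last by move=> n; rewrite py.
  split=> [|n]; first by rewrite pb.
  by rewrite pb Negz_add1.
move=> [q [q0 qS] qx] [p [p0 pS] py].
exists (fun i => match i with Posz n => q n | Negz n => p n end);
  last by case=> n /=.
case=> [n|[|n]].
- by rewrite Posz_add1 qS.
- by rewrite /= p0 -q0.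
- by rewrite Negz_add1 pS.
Qed.

(** [Pinf X x] depends only on the set of vertices of a finite presentation from which [x] can be
    read. *)
Lemma finite_krieger : finite_lgraph (krieger X).
Proof.
have [_ [G [[finG _] XG]]] := soficX.
apply: finite_rel_graph; apply: finite_set_type.
apply: (@sub_finite_set _ _
  ((fun W : set (vert G) => \bigcup_(v in W) past v) @` setT)); last first.
  by apply: finite_image; apply: finite_powerset.
by move=> _ [x _ <-]; rewrite (Pinf_presented _ XG); eexists.
Qed.

Lemma krieger_vert_nonempty P : krieger_vert X P -> P !=set0.
Proof.
move=> [_ [z Xz <-] <-]; exists (fun n => z (Negz n)); rewrite PinfE /=.
suff -> : glue (fun n => z (Negz n)) (fun n => z (Posz n)) = z by [].
by apply/funext => -[].
Qed.

Lemma krieger_vert_cons a P : krieger_vert X P ->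
  [set y | P (cons_ray a y)] !=set0 -> krieger_vert X [set y | P (cons_ray a y)].
Proof.
move=> [x _ <-]; rewrite -Pinf_cons => ne.
by exists (cons_ray a x) => //; exact: Pinf_right_rays.
Qed.

Lemma step_krieger (P Q : vert (krieger X)) a :
  step P a Q <-> val P = [set y | val Q (cons_ray a y)].
Proof.
rewrite step_rel_graph; split=> [[x [_ -> ->]]|PQ]; first exact: Pinf_cons.
have [x Xx Qx] := set_valP Q.
by exists x; rewrite Pinf_cons Qx; split.
Qed.

(** Compactness in a finite presentation, applied to the paths ending at a vertex from which [x] can
    be read. *)
Lemma Pinf_closed x y :
  (forall n, exists z, Pinf X x (cat_ray n y z)) -> Pinf X x y.
Proof.
have [_ [G [[finG _] XG]]] := soficX; rewrite (Pinf_presented _ XG) => xy.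
apply: past_konig => // k; have [z [v xv /pastE[t t0 tS]]] := xy k.
exists t => [|i ik]; first by rewrite t0.
by have := tS i; rewrite /cat_ray ik.
Qed.

Lemma past_krieger (P : vert (krieger X)) : past P = val P.
Proof.
apply/seteqP; split=> y.
  move=> /pastE[t t0 tS].
  (* Every final segment of [y] thus extends to an element of [P], and [P] is closed. *)
  have tP n z : val (t n) z -> val P (cat_ray n y z).
    elim: n z => [|n IHn] z; first by rewrite cat_ray0 t0.
    by rewrite cat_rayS; have /step_krieger -> := tS n; move=> /IHn.
  have [x _ Px] := set_valP P; rewrite -Px; apply: Pinf_closed => n.
  have [z tz] := krieger_vert_nonempty (set_valP (t n)).
  by exists z; rewrite Px; apply: tP.
(* The sets [W n] are the successive predecessors of [P] along [y]; the remaining tail of [y] keeps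
   each of them nonempty, hence a vertex. *)
move=> Py; pose W n := [set z | val P (cat_ray n y z)].
have Wy n : W n (fun i => y (n + i)) by rewrite /W /= cat_ray_drop.
have WS n : W n.+1 = [set z | W n (cons_ray (y n) z)].
  by apply/seteqP; split=> z; rewrite /W /= cat_rayS.
have WK n : krieger_vert X (W n).
  elim: n => [|n IHn].
    suff -> : W 0 = val P by exact: set_valP.
    by apply/seteqP; split=> z; rewrite /W /= cat_ray0.
  rewrite WS; apply: krieger_vert_cons => //.
  by rewrite -WS; eexists; apply: Wy.
apply/pastE; exists (fun n => SigSub (mem_set (WK n)) : vert (krieger X)).
  by apply: val_inj; apply/seteqP; split=> z; rewrite /W /= cat_ray0.
by move=> n; apply/step_krieger => /=.
Qed.

(* An element of [P] lies in an inclusion-minimal vertex contained in [P], and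
   minimality among the vertices containing a given ray forces
   indecomposability. *)
Lemma indecomposable_cover (P : vert (krieger X)) y : val P y ->
  exists Q : vert (krieger X), [/\ indecomposable Q, val Q `<=` val P & val Q y].
Proof.
move=> Py.
have [Q [Qy QP] Qmin] : exists2 Q : vert (krieger X),
    val Q y /\ val Q `<=` val P &
    forall Q' : vert (krieger X), val Q' y /\ val Q' `<=` val P ->
      ~ (val Q' `<` val Q).
  apply: (@finite_minimal _ (fun Q Q' : vert (krieger X) => val Q `<` val Q')
    [set Q | val Q y /\ val Q `<=` val P]).
  - by have [] := finite_krieger.
  - by move=> Q; apply: properxx.
  - by move=> Q1 Q2 Q3 [Q12 Q21] [Q23 _]; split=> [|/(subset_trans Q23)//];
      exact: subset_trans Q23.
  - by exists P; split.
exists Q; split=> // V QV.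
have [Q' VQ' Q'y] : (\bigcup_(Q in V) val Q) y by rewrite -QV.
have Q'Q : val Q' `<=` val Q by rewrite QV; exact: bigcup_sup.
suff <- : Q' = Q by [].
apply: val_inj; apply: contrapT => ne; apply: (Qmin Q').
  by split=> //; apply: subset_trans QP.
by rewrite properEneq; split=> //; apply/eqP.
Qed.

(** * The generalised left Fischer cover: pasts and separation *)

Lemma glfc_step_closed (P Q : vert (krieger X)) a :
  step P a Q -> sub_vert (glfc X) Q -> sub_vert (glfc X) P.
Proof.
move=> [e [eP eQ _]] [I [indI [p Qp]]]; exists I; split=> //.
by exists (e :: p); split; rewrite // eQ.
Qed.

Lemma glfc_indecomposable (P : vert (krieger X)) :
  indecomposable P -> sub_vert (glfc X) P.
Proof. by move=> indP; exists P; split=> //; exists [::]. Qed.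

Definition glfc_rays (Q : vert (glfc X)) : set (nat -> A) := val (val Q).

Lemma glfc_rays_inj : injective glfc_rays.
Proof. by move=> P Q PQ; do 2!apply: val_inj. Qed.

Lemma step_glfc (P Q : vert (glfc X)) a :
  step P a Q <-> glfc_rays P = [set y | glfc_rays Q (cons_ray a y)].
Proof. by rewrite step_induced step_krieger. Qed.

(** Closure under predecessors keeps every left-infinite path of the Krieger cover ending at [P]
    inside the subgraph. *)
Lemma past_glfc (P : vert (glfc X)) : past P = glfc_rays P.
Proof.
rewrite /glfc_rays -past_krieger; apply/seteqP; split=> y /pastE[t t0 tS].
  apply/pastE; exists (fun n => val (t n)) => [|n]; first by rewrite t0.
  by apply/step_induced.
have tW n : sub_vert (glfc X) (t n).
  elim: n => [|n IHn]; first by rewrite t0; exact: set_valP.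
  exact: glfc_step_closed (tS n) IHn.
apply/pastE; exists (fun n => SigSub (mem_set (tW n))).
  exact: val_inj.
by move=> n; apply/step_induced; exact: tS.
Qed.

Lemma finite_glfc : finite_lgraph (glfc X).
Proof.
have [finV finE] := finite_krieger.
by split; apply: finite_set_type; [apply: sub_finite_set finV
                                  |apply: sub_finite_set finE].
Qed.

Lemma edge_glfc_inj (e f : edge (glfc X)) :
  src e = src f -> rng e = rng f -> lab e = lab f -> e = f.
Proof.
move=> /(congr1 val) es /(congr1 val) er el.
by apply: val_inj; apply: edge_rel_graph_inj.
Qed.

Lemma left_resolving_glfc : left_resolving (glfc X).
Proof.
move=> e f er el; apply: edge_glfc_inj => //; apply: glfc_rays_inj.
have /step_glfc -> : step (src e) (lab e) (rng e) by exists e.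
have /step_glfc -> : step (src f) (lab f) (rng f) by exists f.
by rewrite er el.
Qed.

Lemma predecessor_separated_glfc : predecessor_separated (glfc X).
Proof. by move=> u v; rewrite !past_glfc => /glfc_rays_inj. Qed.

(** * The generalised left Fischer cover as a foundation *)

Definition rays_of (V : set (vert (glfc X))) : set (nat -> A) :=
  \bigcup_(Q in V) glfc_rays Q.

Lemma rays_of_preim a V :
  rays_of (word_preim [:: a] V) = [set y | rays_of V (cons_ray a y)].
Proof.
apply/seteqP; split=> y.
  by move=> [u /word_preim1[v Vv /step_glfc ->] vy]; exists v.
move=> [v Vv vy].
have vK := krieger_vert_cons (set_valP (val v)) (ex_intro _ y vy).
pose Q : vert (krieger X) := SigSub (mem_set vK).
have Qv : step Q a (val v) by apply/step_krieger.
exists (SigSub (mem_set (glfc_step_closed Qv (set_valP v)))) => //.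
by apply/word_preim1; exists v => //; apply/step_induced.
Qed.

Lemma rays_of_neq0 V : rays_of V !=set0 <-> V !=set0.
Proof.
split=> [[y [v Vv _]]|[v Vv]]; first by exists v.
by have [y vy] := krieger_vert_nonempty (set_valP (val v)); exists y, v.
Qed.

(** For a Krieger vertex [P], the largest set of vertices with union [P], used as canonical
    representative of its class. *)
Definition glfc_below (P : set (nat -> A)) : set (vert (glfc X)) :=
  [set Q | glfc_rays Q `<=` P].

Lemma rays_of_below (P : vert (krieger X)) : rays_of (glfc_below (val P)) = val P.
Proof.
apply/seteqP; split=> y; first by move=> [Q QP /QP].
move=> /indecomposable_cover[Q [indQ QP Qy]].
by exists (SigSub (mem_set (glfc_indecomposable indQ))).
Qed.

Lemma foundation_glfc : foundation (glfc X) (krieger X).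
Proof.
split; [exact: finite_glfc | exact: left_resolving_glfc
       | exact: predecessor_separated_glfc |].
pose S (V : set (vert (glfc X))) := krieger_vert X (rays_of V).
pose sim U V := rays_of U = rays_of V.
have simP : equivalence_on S sim by split=> // U V W _ _ _; exact: etrans.
have rays1 v : rays_of [set v] = glfc_rays v by rewrite /rays_of bigcup_set1.
have pcS : past_closed S sim.
  split=> [v|u v|V a SV aV|U V a SU SV UV].
  - by rewrite /S rays1; exact: set_valP.
  - by rewrite /sim !rays1; exact: glfc_rays_inj.
  - rewrite /S rays_of_preim; apply: krieger_vert_cons => //.
    by rewrite -rays_of_preim; apply/rays_of_neq0.
  - by rewrite /sim -!rays_of_neq0 !rays_of_preim UV.
exists S, sim; split=> //.
have SB (P : vert (krieger X)) : S (glfc_below (val P)).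
  by rewrite /S rays_of_below; exact: set_valP.
pose f (P : vert (krieger X)) : vert (foundation_graph S sim) := quot sim (SB P).
apply: (@rel_graph_iso _ _ _ _ _ f).
  apply: inj_surj_bijective => [P Q /(congr1 val) /= PQ|C].
    apply: val_inj; rewrite -rays_of_below -[RHS]rays_of_below.
    exact: eq_class_inj simP _ _ (SB P) (SB Q) PQ.
  have [V [SV ->]] := quot_surj C.
  (* The inverse of [f] sends a class to the common union of its members. *)
  pose P : vert (krieger X) :=
    SigSub (mem_set (SV : krieger_vert X (rays_of V))).
  exists P; apply: val_inj; apply: (eq_class_sim simP) => //.
  exact: rays_of_below.
move=> P a Q.
rewrite -/(krieger X) -/(foundation_graph S sim) step_krieger.
have aQ : rays_of (word_preim [:: a] (glfc_below (val Q))) =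
    [set y | val Q (cons_ray a y)] by rewrite rays_of_preim rays_of_below.
have [_ _ pS _] := pcS.
split=> [PQ|/(step_quotP simP pcS)[ne /(eq_class_inj simP)]].
  have ne : word_preim [:: a] (glfc_below (val Q)) !=set0.
    apply/rays_of_neq0; rewrite aQ -PQ.
    exact: krieger_vert_nonempty (set_valP P).
  apply/(step_quotP simP pcS); split; [done|apply: (eq_class_sim simP)].
  - exact: SB.
  - exact: pS (SB _) ne.
  - by rewrite /sim aQ rays_of_below.
by rewrite /sim aQ rays_of_below; apply; [exact: SB | exact: pS (SB _) ne].
Qed.

(** * Embedding a foundation into the Krieger cover; minimality *)

Lemma foundation_cover (F : lgraph A) : foundation F (krieger X) ->
  exists g : vert F -> vert (krieger X),
    (forall u a v, step (g u) a (g v) -> step u a v) /\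
    (forall P, sub_vert (glfc X) P -> exists v, P = g v).
Proof.
move=> [[finF _] lrF _ [S [sim [simP pcS isoF]]]].
have [f bijf fS] := lgraph_iso_step isoF.
have fpast := past_iso bijf fS.
have [f' fK f'K] := bijf.
have [S1 sim1 pS _] := pcS.
pose c v := quot sim (S1 v); pose g v := f' (c v).
have g_inj : injective g.
  move=> u v /(congr1 f); rewrite !f'K => /(congr1 val) /= uv.
  exact: sim1 (eq_class_inj simP (S1 u) (S1 v) uv).
have g_past v : val (g v) = past v.
  rewrite -past_krieger -fpast f'K past_quot //.
  by rewrite bigcup_set1.
(* As [F] is left-resolving, a nonempty preimage of a singleton under one letter is a singleton; so
   the image of [g] is closed under predecessors. *)
have g_step P a v : step P a (g v) -> exists2 u, P = g u & step u a v.
  rewrite fS f'K => /(step_quotP simP pcS)[ne Pa].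
  have [u /word_preim1[_ -> uv]] := ne; exists u => //.
  apply: (bij_inj bijf); rewrite f'K; apply: val_inj; rewrite Pa /=; congr eq_class.
  apply/seteqP; split=> [w /word_preim1[_ -> [e [ew ev ea]]]|_ ->].
    have [e' [e'u e'v e'a]] := uv.
    by rewrite -ew -e'u; congr src; apply: lrF; rewrite ?ev ?ea.
  by apply/word_preim1; exists v.
exists g; split=> [u a v /g_step[w /g_inj -> //]|P [I [indI [p]]]].
elim: p P => [P ->|e p IHp P [<- /IHp[v ev]]]; last first.
  have /g_step[u -> _] : step (src e) (lab e) (g v) by exists e.
  by exists u.
(* If [I] corresponds to the class of [V], then [I] is the union of the [g v] for [v] in [V], and
   indecomposability makes it one of them. *)
have [V [SV fIV]] := quot_surj (f I).
have [|v _ <-] := indI (g @` V); last by exists v.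
rewrite -past_krieger -fpast fIV past_quot //.
rewrite bigcup_image; apply: eq_bigcupr => v _; by rewrite g_past.
Qed.

(** Choosing preimages under [g] injects the vertices and edges of the whole cover into those of
    [F]. Followed by the inclusion of [F], these are injective self-maps of finite sets, hence
    onto. *)
Lemma glfc_minimal (F : subgraph (glfc X)) :
  foundation F (krieger X) -> ~ proper_subgraph F.
Proof.
move=> /foundation_cover[g [g_step g_surj]]; apply.
have [finV finE] := finite_glfc.
have /choice[s sP] (P : vert (glfc X)) : exists v : vert F, val P = g v.
  exact: g_surj (set_valP P).
have s_inj : injective (fun P => val (s P)).
  by move=> P Q /val_inj PQ; apply: val_inj; rewrite !sP PQ.
have /choice[h hP] (e : edge (glfc X)) : exists e' : edge F,
    [/\ src e' = s (src e), rng e' = s (rng e) & lab e' = lab e].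
  apply: g_step; rewrite -!sP; apply/step_induced; by exists e.
have h_inj : injective (fun e => val (h e)).
  move=> e1 e2 /val_inj e12; have [[s1 r1 l1] [s2 r2 l2]] := (hP e1, hP e2).
  apply: edge_glfc_inj.
  - by apply: s_inj; rewrite -s1 -s2 e12.
  - by apply: s_inj; rewrite -r1 -r2 e12.
  - by rewrite -l1 -l2 e12.
split; apply/seteqP; split=> // x _.
  by have [y <-] := finite_inj_surj finV s_inj x; exact: set_valP.
by have [y <-] := finite_inj_surj finE h_inj x; exact: set_valP.
Qed.

End Krieger.

Theorem theorem3p19 (A : finType) (X : set (int -> A)) (hX : sofic X) :
  foundation (glfc X) (krieger X) /\
  (forall F : subgraph (glfc X), proper_subgraph F -> ~ foundation F (krieger X)).
Proof.
by split=> [|F prF /(glfc_minimal hX)]; first exact: foundation_glfc.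
Qed.
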